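(* Let $\mathfrak{A}$ be a unital Banach algebra, and let $\mathfrak{J}$ be an ideal of $\mathfrak{A}$ such that the quotient map $\pi$ of $\mathfrak{A}$ onto $\mathfrak{A}/\mathfrak{J}$ is split (that is, $0\to\mathfrak{J}\to\mathfrak{A}\to\mathfrak{A}/\mathfrak{J}\to0$ is split exact). Then: (i) $\mathrm{rtsr}(\mathfrak{J})\le \mathrm{rtsr}(\mathfrak{A})$. (ii) If $\mathrm{tsr}(\mathfrak{A}/\mathfrak{J})=1$, then $\mathrm{rtsr}(\mathfrak{J})=\mathrm{rtsr}(\mathfrak{A})$. (iii) If $\mathfrak{A}/\mathfrak{J}$ is completely finite, then $$\mathrm{rtsr}(\mathfrak{A})=\max\{\mathrm{rtsr}(\mathfrak{A}/\mathfrak{J}),\ \mathrm{rtsr}(\mathfrak{J})\}.$$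
   Context: Ideals are closed and two-sided. The quotient map $\pi$ is split if there is a continuous unital algebra homomorphism $\sigma:\mathfrak{A}/\mathfrak{J}\to\mathfrak{A}$ with $\pi\sigma=\mathrm{id}$. For a unital Banach algebra $\mathfrak{A}$, $Rg_n(\mathfrak{A})$ is the set of $(a_1,\dots,a_n)\in\mathfrak{A}^n$ for which there is $(b_1,\dots,b_n)\in\mathfrak{A}^n$ with $\sum_{i=1}^n a_ib_i=1$. The right topological stable rank $\mathrm{rtsr}(\mathfrak{A})$ is the least positive integer $n$ such that $Rg_n(\mathfrak{A})$ is dense in $\mathfrak{A}^n$, or $\infty$ if there is none. The left topological stable rank $\mathrm{ltsr}(\mathfrak{A})$ is defined analogously with $\sum b_ia_i=1$; when $\mathrm{ltsr}(\mathfrak{A})=\mathrm{rtsr}(\mathfrak{A})$ the common value is denoted $\mathrm{tsr}(\mathfrak{A})$. If an algebra is not unital, its stable ranks are those of its unitization. A unital Banach algebra $\mathfrak{B}$ is completely finite if for all $n\ge1$ every right invertible $1\times n$ row $R$ over $\mathfrak{B}$ (i.e. $RC=1$ for some $n\times1$ column $C$ over $\mathfrak{B}$) is the first row of an invertible matrix in $\mathfrak{M}_n(\mathfrak{B})$. *)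

(* Defs.v *)
From HB Require Import structures.
From mathcomp Require Import all_boot all_order all_algebra complex.
From mathcomp Require Import generic_quotient ring_quotient.
From mathcomp Require Import boolp classical_sets reals ereal topology.
From mathcomp Require Import normedtype.

Set Implicit Arguments.
Unset Strict Implicit.
Unset Printing Implicit Defensive.

Import Order.TTheory GRing.Theory Num.Theory.
Import numFieldNormedType.Exports.

Local Open Scope classical_set_scope.
Local Open Scope ring_scope.
Local Open Scope quotient_scope.
Local Open Scope complex_scope.

Reserved Notation "x ** y" (at level 40, left associativity).

(* Associative normed algebras, not necessarily unital. The product is an
   operation of its own: a join of the library's ring and normed-module
   structures would clash with [numDomainType], and rings have a 1. *)
HB.mixin Record isNormedAlgebra (K : numFieldType) A & NormedModule K A := {
  amul : A -> A -> A;
  amulA : associative amul;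
  amulDl : left_distributive amul +%R;
  amulDr : right_distributive amul +%R;
  amulZl : forall (k : K) (x y : A), amul (k *: x) y = k *: amul x y;
  amulZr : forall (k : K) (x y : A), amul x (k *: y) = k *: amul x y;
  ler_norm_amul : forall x y : A, `|amul x y| <= `|x| * `|y| }.

#[short(type="normedAlgType")]
HB.structure Definition NormedAlgebra (K : numFieldType) :=
  {A of NormedModule K A & isNormedAlgebra K A}.

(* Completeness is only part of [banachAlgType]; the constructions below need
   just a normed algebra, and the stable ranks depend only on the product and
   the topology. *)
#[short(type="banachAlgType")]
HB.structure Definition BanachAlgebra (K : numFieldType) :=
  {A of NormedAlgebra K A & Complete A}.

Notation "x ** y" := (amul x y) : ring_scope.

Section NormedAlgebraTheory.
Variables (K : numFieldType) (A : normedAlgType K).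
Implicit Types x y z : A.

Lemma amul0x y : 0 ** y = 0.
Proof. by apply: (addIr (0 ** y)); rewrite -amulDl !add0r. Qed.

Lemma amulx0 x : x ** 0 = 0.
Proof. by apply: (addIr (x ** 0)); rewrite -amulDr !add0r. Qed.

Lemma amulNx x y : (- x) ** y = - (x ** y).
Proof. by rewrite -scaleN1r amulZl scaleN1r. Qed.

Lemma amulxN x y : x ** (- y) = - (x ** y).
Proof. by rewrite -scaleN1r amulZr scaleN1r. Qed.

(* No condition on the norm of the identity: an ideal may have an identity
   element of norm greater than 1. *)
Definition is_identity (e : A) : Prop := forall x, e ** x = x /\ x ** e = x.

Definition unital : Prop := exists e, is_identity e.

Lemma is_identity_uniq e f : is_identity e -> is_identity f -> e = f.
Proof. by move=> ide idf; rewrite -(idf e).1 (ide f).2. Qed.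

End NormedAlgebraTheory.
Arguments unital {K} A.

Section Unitization.
Variables (K : numFieldType) (V : normedAlgType K).

(* (k, x) stands for k1 + x, with the norm |k| + |x|. *)
Definition unitization : Type := (K^o * V)%type.

HB.instance Definition _ := GRing.Lmodule.copy unitization (K^o * V)%type.

Let unorm (u : unitization) : K := `|u.1| + `|u.2|.

Let unormD (u v : unitization) : unorm (u + v) <= unorm u + unorm v.
Proof. by rewrite /unorm addrACA lerD// ler_normD. Qed.

Let unormZ (k : K) (u : unitization) : unorm (k *: u) = `|k| * unorm u.
Proof. by rewrite /unorm mulrDr normrM normrZ. Qed.

Let unorm_eq0 (u : unitization) : unorm u = 0 -> u = 0.
Proof.
case: u => k x /eqP; rewrite paddr_eq0// => /andP[/= /eqP k0 /eqP x0].
by congr pair; [exact: normr0_eq0 k0|exact: normr0_eq0 x0].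
Qed.

HB.instance Definition _ := Lmodule_isNormed.Build K unitization
  unormD unormZ unorm_eq0.

Let umul (u v : unitization) : unitization :=
  (u.1 * v.1, u.1 *: v.2 + v.1 *: u.2 + u.2 ** v.2).

Let umulA : associative umul.
Proof.
move=> [k x] [l y] [m z]; congr pair => /=; first by rewrite mulrA.
rewrite !scalerDr !amulDl !amulDr !amulZl !amulZr !scalerA amulA.
rewrite [m * k]mulrC [m * l]mulrC -!addrA; do 2 congr (_ + _).
rewrite addrCA; congr (_ + _).
by rewrite [RHS]addrCA; congr (_ + _); rewrite addrCA.
Qed.

Let umulDl : left_distributive umul +%R.
Proof.
move=> [k x] [l y] [m z]; congr pair => /=; first by rewrite mulrDl.
rewrite scalerDl scalerDr amulDl.
by rewrite [RHS]addrACA; congr (_ + _); rewrite addrACA.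
Qed.

Let umulDr : right_distributive umul +%R.
Proof.
move=> [k x] [l y] [m z]; congr pair => /=; first by rewrite mulrDr.
rewrite scalerDl scalerDr amulDr.
by rewrite [RHS]addrACA; congr (_ + _); rewrite addrACA.
Qed.

Let umulZl (k : K) (u v : unitization) : umul (k *: u) v = k *: umul u v.
Proof.
case: u v => [l x] [m y]; congr pair => /=; first by rewrite -mulrA.
by rewrite !scalerDr amulZl !scalerA [m * k]mulrC.
Qed.

Let umulZr (k : K) (u v : unitization) : umul u (k *: v) = k *: umul u v.
Proof.
case: u v => [l x] [m y]; congr pair => /=; first by rewrite mulrCA.
by rewrite !scalerDr amulZr !scalerA [l * k]mulrC.
Qed.

Let umul_norm (u v : unitization) : `|umul u v| <= `|u| * `|v|.
Proof.
case: u v => [l x] [m y].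
rewrite -[leLHS]/(unorm _) -[`|_ : unitization|]/(unorm _).
rewrite -[X in _ * X]/(unorm _) /unorm/=.
rewrite mulrDl !mulrDr normrM -[leRHS]addrA lerD2l [leRHS]addrA.
rewrite (le_trans (ler_normD _ _))// lerD ?ler_norm_amul//.
by rewrite (le_trans (ler_normD _ _))// !normrZ [`|m| * _]mulrC.
Qed.

HB.instance Definition _ := isNormedAlgebra.Build K unitization
  umulA umulDl umulDr umulZl umulZr umul_norm.

Lemma amul_unitizationE (u v : unitization) :
  u ** v = (u.1 * v.1, u.1 *: v.2 + v.1 *: u.2 + u.2 ** v.2).
Proof. by []. Qed.

Lemma norm_unitizationE (u : unitization) : `|u| = `|u.1| + `|u.2|.
Proof. by []. Qed.

Lemma unitization_identity : is_identity ((1, 0) : unitization).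
Proof.
move=> [k x]; rewrite !amul_unitizationE/= amul0x amulx0 !addr0.
by rewrite scaler0 !scale1r mul1r mulr1 addr0 add0r.
Qed.

Lemma unitization_unital : unital unitization.
Proof. by exists (1, 0); exact: unitization_identity. Qed.

End Unitization.

HB.mixin Record isClosedIdeal (K : numFieldType) (A : normedAlgType K)
    (J : {pred A}) := {
  ideal_scale : forall (k : K) (x : A), x \in J -> k *: x \in J;
  ideal_mull : forall a x : A, x \in J -> a ** x \in J;
  ideal_mulr : forall a x : A, x \in J -> x ** a \in J;
  ideal_closed : closed [set x | x \in J] }.

#[short(type="closedIdeal")]
HB.structure Definition ClosedIdeal (K : numFieldType) (A : normedAlgType K) :=
  {J of GRing.ZmodClosed A J & isClosedIdeal K A J}.

Section IdealAlgebra.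
Variables (K : numFieldType) (A : normedAlgType K) (J : closedIdeal A).

Record ideal_alg : Type :=
  IdealAlg { ideal_val :> A; ideal_valP : ideal_val \in J }.

HB.instance Definition _ := [isSub for ideal_val].
HB.instance Definition _ := [Choice of ideal_alg by <:].
HB.instance Definition _ := [SubChoice_isSubZmodule of ideal_alg by <:].

Let ideal_submod : subsemimod_closed (fun x : A => x \in J).
Proof. by split; [exact: rpred0D|move=> k x; exact: ideal_scale]. Qed.

HB.instance Definition _ :=
  GRing.SubZmodule_isSubLmodule.Build K A _ ideal_alg ideal_submod.

Let inorm (x : ideal_alg) : K := `|ideal_val x|.

Let inormD (x y : ideal_alg) : inorm (x + y) <= inorm x + inorm y.
Proof. exact: ler_normD. Qed.

Let inormZ (k : K) (x : ideal_alg) : inorm (k *: x) = `|k| * inorm x.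
Proof. exact: normrZ. Qed.

Let inorm_eq0 (x : ideal_alg) : inorm x = 0 -> x = 0.
Proof. by move=> /normr0_eq0 x0; apply: val_inj. Qed.

HB.instance Definition _ := Lmodule_isNormed.Build K ideal_alg
  inormD inormZ inorm_eq0.

Let imul (x y : ideal_alg) : ideal_alg :=
  IdealAlg (ideal_mull (ideal_val x) _ (ideal_valP y)).

Let imulA : associative imul.
Proof. by move=> x y z; apply: val_inj; exact: amulA. Qed.

Let imulDl : left_distributive imul +%R.
Proof. by move=> x y z; apply: val_inj; exact: amulDl. Qed.

Let imulDr : right_distributive imul +%R.
Proof. by move=> x y z; apply: val_inj; exact: amulDr. Qed.

Let imulZl (k : K) (x y : ideal_alg) : imul (k *: x) y = k *: imul x y.
Proof. by apply: val_inj; exact: amulZl. Qed.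

Let imulZr (k : K) (x y : ideal_alg) : imul x (k *: y) = k *: imul x y.
Proof. by apply: val_inj; exact: amulZr. Qed.

Let imul_norm (x y : ideal_alg) : `|imul x y| <= `|x| * `|y|.
Proof. exact: ler_norm_amul. Qed.

HB.instance Definition _ := isNormedAlgebra.Build K ideal_alg
  imulA imulDl imulDr imulZl imulZr imul_norm.

Lemma ideal_amulE (x y : ideal_alg) : ideal_val (x ** y) = x ** y.
Proof. by []. Qed.

Lemma ideal_normE (x : ideal_alg) : `|x| = `|ideal_val x|.
Proof. by []. Qed.

End IdealAlgebra.

Section Quotient.
Variables (R : realType) (A : normedAlgType R[i]) (J : closedIdeal A).

Definition quotient : Type := Quotient.quot J.

HB.instance Definition _ := GRing.Zmodule.on quotient.

Definition quo (a : A) : quotient := \pi_(Quotient.quot J) a.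

Lemma quo_surj (x : quotient) : exists a, quo a = x.
Proof. by exists (repr (x : Quotient.quot J)); rewrite /quo reprK. Qed.

Lemma quo_eq (a b : A) : quo a = quo b <-> a - b \in J.
Proof.
rewrite /quo; split => [/eqP|]; first by rewrite -Quotient.idealrBE.
by rewrite Quotient.idealrBE => /eqP.
Qed.

Lemma quoD (a b : A) : quo (a + b) = quo a + quo b.
Proof. exact: Quotient.pi_add. Qed.

Lemma quo0 : quo 0 = 0.
Proof. by apply: (addIr (quo 0)); rewrite -quoD !add0r. Qed.

Lemma quoN (a : A) : quo (- a) = - quo a.
Proof. exact: Quotient.pi_opp. Qed.

Lemma quo_repr (x : quotient) : quo (repr (x : Quotient.quot J)) = x.
Proof. by rewrite /quo reprK. Qed.

Lemma repr_quo (a : A) : repr (quo a : Quotient.quot J) - a \in J.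
Proof. by apply/quo_eq; rewrite quo_repr. Qed.

Definition qmul (x y : quotient) : quotient :=
  quo (repr (x : Quotient.quot J) ** repr (y : Quotient.quot J)).

Definition qscale (k : R[i]) (x : quotient) : quotient :=
  quo (k *: repr (x : Quotient.quot J)).

Lemma quoM (a b : A) : quo (a ** b) = qmul (quo a) (quo b).
Proof.
apply/esym/quo_eq; set a' := repr _; set b' := repr _.
have -> : a' ** b' - a ** b = (a' - a) ** b' + a ** (b' - b).
  by rewrite amulDl amulDr amulNx amulxN addrA subrK.
by apply: rpredD; [apply: ideal_mulr|apply: ideal_mull]; exact: repr_quo.
Qed.

Lemma quoZ (k : R[i]) (a : A) : quo (k *: a) = qscale k (quo a).
Proof.
apply/esym/quo_eq; rewrite -scalerBr.
by apply: ideal_scale; exact: repr_quo.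
Qed.

Let qmulA : associative qmul.
Proof.
move=> x y z; have [a <-] := quo_surj x; have [b <-] := quo_surj y.
have [c <-] := quo_surj z.
by rewrite -!quoM amulA.
Qed.

Let qmulDl : left_distributive qmul +%R.
Proof.
move=> x y z; have [a <-] := quo_surj x; have [b <-] := quo_surj y.
have [c <-] := quo_surj z.
by rewrite -quoD -!quoM amulDl quoD.
Qed.

Let qmulDr : right_distributive qmul +%R.
Proof.
move=> x y z; have [a <-] := quo_surj x; have [b <-] := quo_surj y.
have [c <-] := quo_surj z.
by rewrite -quoD -!quoM amulDr quoD.
Qed.

Let qscaleA k l x : qscale k (qscale l x) = qscale (k * l) x.
Proof. by have [a <-] := quo_surj x; rewrite -!quoZ scalerA. Qed.

Let qscale1 : left_id 1 qscale.
Proof. by move=> x; have [a <-] := quo_surj x; rewrite -quoZ scale1r. Qed.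

Let qscaleDr : right_distributive qscale +%R.
Proof.
move=> k x y; have [a <-] := quo_surj x; have [b <-] := quo_surj y.
by rewrite -quoD -!quoZ scalerDr quoD.
Qed.

Let qscaleDl x : {morph qscale^~ x : k l / k + l}.
Proof.
by move=> k l; have [a <-] := quo_surj x; rewrite -!quoZ scalerDl quoD.
Qed.

HB.instance Definition _ := GRing.Zmodule_isLmodule.Build R[i] quotient
  qscaleA qscale1 qscaleDr qscaleDl.

(* Over R[i] the library's norm takes its values in R[i], while infima exist
   only in R: hence the passage through real parts. *)
Definition qnorm_real (x : quotient) : R :=
  inf [set complex.Re `|a| | a in [set a | quo a = x]].

Definition qnorm (x : quotient) : R[i] := (qnorm_real x)%:C.

Let ReE (a : A) : (complex.Re `|a|)%:C = `|a|.
Proof. by rewrite RRe_real// normr_real. Qed.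

Let Re_ge0 (a : A) : 0 <= complex.Re `|a|.
Proof. by rewrite -ler0c ReE. Qed.

Let qlb (x : quotient) :
  has_lbound [set complex.Re `|a| | a in [set a | quo a = x]].
Proof. by exists 0 => _ [a _ <-]; exact: Re_ge0. Qed.

Let qne (x : quotient) :
  [set complex.Re `|a| | a in [set a | quo a = x]] !=set0.
Proof. by have [a ax] := quo_surj x; exists (complex.Re `|a|), a. Qed.

Let qnorm_le (a : A) : qnorm_real (quo a) <= complex.Re `|a|.
Proof. by apply: ge_inf; [exact: qlb|exists a]. Qed.

Let qnorm_ge0 (x : quotient) : 0 <= qnorm_real x.
Proof. by apply: lb_le_inf; [exact: qne|move=> _ [a _ <-]; exact: Re_ge0]. Qed.

Let qnorm_adh (x : quotient) (e : R) : 0 < e ->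
  exists2 a, quo a = x & complex.Re `|a| < qnorm_real x + e.
Proof.
move=> e0.
by have [_ [a ax <-]] := inf_adherent e0 (conj (qne x) (qlb x)); exists a.
Qed.

Let qnormD (x y : quotient) : qnorm (x + y) <= qnorm x + qnorm y.
Proof.
rewrite /qnorm -rmorphD lecR; apply/ler_addgt0Pr => e e0.
have e20 : 0 < e / 2 by rewrite divr_gt0.
have [a ax ale] := qnorm_adh x e20; have [b bx ble] := qnorm_adh y e20.
rewrite -{1}ax -{1}bx -quoD (le_trans (qnorm_le _))//.
have : complex.Re `|a + b| <= complex.Re `|a| + complex.Re `|b|.
  by rewrite -lecR rmorphD/= !ReE ler_normD.
move=> /le_trans; apply.
by rewrite [e]splitr addrACA lerD// ltW.
Qed.

Let qnormZ_le (k : R[i]) (x : quotient) : qnorm (k *: x) <= `|k| * qnorm x.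
Proof.
have kE : (complex.Re `|k|)%:C = `|k| by rewrite RRe_real// normr_real.
have k0 : 0 <= complex.Re `|k| by rewrite -ler0c kE.
rewrite -kE /qnorm -rmorphM lecR; apply/ler_addgt0Pr => e e0.
have d0 : 0 < e / (complex.Re `|k| + 1) by rewrite divr_gt0// ltr_wpDl.
have [a ax ale] := qnorm_adh x d0.
rewrite -{1}ax -[_ *: _]quoZ (le_trans (qnorm_le _))//.
have -> : complex.Re `|k *: a| = complex.Re `|k| * complex.Re `|a|.
  by apply: complexI; rewrite rmorphM/= !ReE kE normrZ.
rewrite (le_trans (ler_wpM2l k0 (ltW ale)))// mulrDr lerD2l.
rewrite mulrCA ler_piMr ?(ltW e0)//.
by rewrite ler_pdivrMr ?mul1r ?lerDl ?ler01// ltr_wpDl.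
Qed.

Let qnormZ (k : R[i]) (x : quotient) : qnorm (k *: x) = `|k| * qnorm x.
Proof.
have [->|k0] := eqVneq k 0.
  rewrite normr0 mul0r scale0r; apply/le_anti/andP; split; last first.
    by rewrite lecR.
  by rewrite -(scale0r x) (le_trans (qnormZ_le _ _))// normr0 mul0r.
apply/le_anti/andP; split; first exact: qnormZ_le.
rewrite -ler_pdivlMl ?normr_gt0// -normfV.
by rewrite (le_trans _ (qnormZ_le _ _))// scalerA mulVf// scale1r.
Qed.

Let qnorm_eq0 (x : quotient) : qnorm x = 0 -> x = 0.
Proof.
have [a <-] := quo_surj x; move=> /complexI na0.
rewrite -quo0; apply/quo_eq; rewrite subr0.
apply: (@ideal_closed _ _ J) => U /nbhs_ballP[/= e e0 aU].
have e0' : 0 < complex.Re e by rewrite -ltcR RRe_real// gtr0_real.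
have [b ba] := qnorm_adh (quo a) e0'; rewrite na0 add0r => be.
exists (a - b); split; first by apply/quo_eq.
apply: aU; rewrite -ball_normE /= opprB addrC subrK.
by rewrite -ReE -(RRe_real (gtr0_real e0)) ltcR.
Qed.

HB.instance Definition _ := Lmodule_isNormed.Build R[i] quotient
  qnormD qnormZ qnorm_eq0.

Let qmulZl (k : R[i]) (x y : quotient) : qmul (k *: x) y = k *: qmul x y.
Proof.
have [a <-] := quo_surj x; have [b <-] := quo_surj y.
by rewrite -[k *: quo a]quoZ -!quoM -[RHS]quoZ amulZl.
Qed.

Let qmulZr (k : R[i]) (x y : quotient) : qmul x (k *: y) = k *: qmul x y.
Proof.
have [a <-] := quo_surj x; have [b <-] := quo_surj y.
by rewrite -[k *: quo b]quoZ -!quoM -[RHS]quoZ amulZr.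
Qed.

Let qmul_norm (x y : quotient) : `|qmul x y| <= `|x| * `|y|.
Proof.
have key a b :
    qnorm_real (qmul (quo a) (quo b)) <= complex.Re `|a| * complex.Re `|b|.
  rewrite -quoM (le_trans (qnorm_le _))//.
  by rewrite -lecR rmorphM/= !ReE ler_norm_amul.
have step a : qnorm_real (qmul (quo a) y) <= complex.Re `|a| * qnorm_real y.
  have := Re_ge0 a; rewrite le_eqVlt => /predU1P[a0|a0].
    by have [b <-] := quo_surj y; rewrite (le_trans (key a b))// -a0 !mul0r.
  rewrite -ler_pdivrMl//; apply: lb_le_inf; first exact: qne.
  by move=> _ [b <- <-]; rewrite ler_pdivrMl.
rewrite -[leLHS]/(qnorm _) -[`|x|]/(qnorm x) -[`|y|]/(qnorm y).
rewrite /qnorm -rmorphM lecR.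
have := qnorm_ge0 y; rewrite le_eqVlt => /predU1P[y0|y0].
  by have [a <-] := quo_surj x; rewrite (le_trans (step a))// -y0 !mulr0.
rewrite -ler_pdivrMr//; apply: lb_le_inf; first exact: qne.
by move=> _ [a <- <-]; rewrite ler_pdivrMr.
Qed.

HB.instance Definition _ := isNormedAlgebra.Build R[i] quotient
  qmulA qmulDl qmulDr qmulZl qmulZr qmul_norm.

Lemma quo_amul (a b : A) : quo (a ** b) = quo a ** quo b.
Proof. exact: quoM. Qed.

Lemma quo_scale (k : R[i]) (a : A) : quo (k *: a) = k *: quo a.
Proof. exact: quoZ. Qed.

Lemma quo_normE (x : quotient) :
  `|x| = (inf [set complex.Re `|a| | a in [set a | quo a = x]])%:C.
Proof. by []. Qed.

Definition split_quotient : Prop :=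
  exists sigma : quotient -> A,
    [/\ linear sigma, {morph sigma : x y / x ** y},
        forall e, is_identity e -> is_identity (sigma e),
        continuous sigma & cancel sigma quo].

End Quotient.

Section StableRank.
Variables (R : realType) (B : normedAlgType R[i]).

(* "is the identity" stands for "= 1", the identity element being unique when
   it exists. *)
Definition Rg (n : nat) : set 'rV[B]_n :=
  [set a | exists b : 'rV[B]_n,
     is_identity (\sum_(i < n) a ord0 i ** b ord0 i)].

Definition Lg (n : nat) : set 'rV[B]_n :=
  [set a | exists b : 'rV[B]_n,
     is_identity (\sum_(i < n) b ord0 i ** a ord0 i)].

(* The least positive n such that P n, and +oo if there is none. *)
Definition least_pos (P : nat -> Prop) : \bar R :=
  if pselect (exists n, `[< (0 < n)%N /\ P n >]) is left exP
  then ((ex_minn exP)%:R)%:E else +oo%E.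

Definition unital_rtsr : \bar R := least_pos (fun n => dense (@Rg n)).
Definition unital_ltsr : \bar R := least_pos (fun n => dense (@Lg n)).

Definition mmul (m n p : nat) (M : 'M[B]_(m, n)) (N : 'M[B]_(n, p)) :
  'M[B]_(m, p) := \matrix_(i, k) \sum_j M i j ** N j k.

Definition is_identity_mx (n : nat) (M : 'M[B]_n) : Prop :=
  forall i j, if i == j then is_identity (M i j) else M i j = 0.

(* Sizes are n.+1 with n : nat, that is, all sizes n >= 1. *)
Definition completely_finite : Prop :=
  unital B /\ forall (n : nat) (r : 'rV[B]_n.+1),
    (exists c : 'cV[B]_n.+1, is_identity_mx (mmul r c)) ->
    exists M N : 'M[B]_n.+1,
      [/\ is_identity_mx (mmul M N), is_identity_mx (mmul N M)
        & row ord0 M = r].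

End StableRank.

Definition rtsr (R : realType) (B : normedAlgType R[i]) : \bar R :=
  if `[< unital B >] then unital_rtsr B else unital_rtsr (unitization B).

Definition ltsr (R : realType) (B : normedAlgType R[i]) : \bar R :=
  if `[< unital B >] then unital_ltsr B else unital_ltsr (unitization B).

Definition has_tsr (R : realType) (B : normedAlgType R[i]) (t : \bar R) :=
  ltsr B = t /\ rtsr B = t.

(* Main.v *)
(* Write p = sigma o quo, an idempotent endomorphism of A with kernel J, so that
   the unitization of J maps to the elements of A that p sends to scalars.
   (i) A row over this subalgebra, approximated by a right invertible row a of
   A, need not be approximated inside it; but p(a) is close to the scalar row
   lambda, and a right multiplication by 1 - mu U (p(a) - lambda), a rank one
   perturbation of the identity, corrects a so that p(a) = lambda exactly. A
   right inverse can then be modified to have a scalar image under p as well.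
   (ii), (iii) Conversely, if the image of a in A/J is the first row of an
   invertible matrix over A/J, then lifting this matrix by sigma moves a to a
   row congruent to (1, 0, ..., 0) modulo J, where the density for J applies.
   Such first rows are dense under either hypothesis on A/J. When J has its own
   identity, that identity is central in A and splits off as a direct factor. *)
Require Import Defs.
From HB Require Import structures.
From mathcomp Require Import all_boot all_order all_algebra complex.
From mathcomp Require Import boolp classical_sets reals ereal topology.
From mathcomp Require Import normedtype ring.

Set Implicit Arguments.
Unset Strict Implicit.
Unset Printing Implicit Defensive.

Import Order.TTheory GRing.Theory Num.Theory.
Import numFieldNormedType.Exports.

Local Open Scope classical_set_scope.
Local Open Scope ring_scope.

Local Notation "M *** N" := (mmul M N) (at level 40, left associativity).

(** * Matrices over a normed algebra and rank one perturbations of the identity *)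

Section MatrixProduct.
Variables (R : realType) (A : normedAlgType R[i]).

Lemma amul_sumr (I : Type) (r : seq I) (P : pred I) (F : I -> A) (x : A) :
  x ** (\sum_(i <- r | P i) F i) = \sum_(i <- r | P i) x ** F i.
Proof. by apply: (big_morph _ (amulDr x)); exact: amulx0. Qed.

Lemma amul_suml (I : Type) (r : seq I) (P : pred I) (F : I -> A) (x : A) :
  (\sum_(i <- r | P i) F i) ** x = \sum_(i <- r | P i) F i ** x.
Proof.
by apply: (big_morph (amul^~ x) (fun u v => amulDl u v x)); exact: amul0x.
Qed.

Lemma mmulA (m n p q : nat) (M : 'M[A]_(m, n)) (N : 'M[A]_(n, p))
    (P : 'M[A]_(p, q)) : M *** (N *** P) = M *** N *** P.
Proof.
apply/matrixP => i l; rewrite !mxE.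
under eq_bigr do rewrite mxE amul_sumr.
rewrite exchange_big; apply: eq_bigr => k _.
by rewrite mxE amul_suml; apply: eq_bigr => j _; exact: amulA.
Qed.

Lemma mmulDl (m n p : nat) (M N : 'M[A]_(m, n)) (P : 'M[A]_(n, p)) :
  (M + N) *** P = M *** P + N *** P.
Proof.
apply/matrixP => i k; rewrite !mxE -big_split.
by apply: eq_bigr => j _; rewrite mxE amulDl.
Qed.

Lemma mmulDr (m n p : nat) (M : 'M[A]_(m, n)) (N P : 'M[A]_(n, p)) :
  M *** (N + P) = M *** N + M *** P.
Proof.
apply/matrixP => i k; rewrite !mxE -big_split.
by apply: eq_bigr => j _; rewrite mxE amulDr.
Qed.

Lemma mmulNl (m n p : nat) (M : 'M[A]_(m, n)) (N : 'M[A]_(n, p)) :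
  (- M) *** N = - (M *** N).
Proof.
apply/matrixP => i k; rewrite !mxE -sumrN.
by apply: eq_bigr => j _; rewrite mxE amulNx.
Qed.

Lemma mmulNr (m n p : nat) (M : 'M[A]_(m, n)) (N : 'M[A]_(n, p)) :
  M *** (- N) = - (M *** N).
Proof.
apply/matrixP => i k; rewrite !mxE -sumrN.
by apply: eq_bigr => j _; rewrite mxE amulxN.
Qed.

Lemma mmulBl (m n p : nat) (M N : 'M[A]_(m, n)) (P : 'M[A]_(n, p)) :
  (M - N) *** P = M *** P - N *** P.
Proof. by rewrite mmulDl mmulNl. Qed.

Lemma mmulBr (m n p : nat) (M : 'M[A]_(m, n)) (N P : 'M[A]_(n, p)) :
  M *** (N - P) = M *** N - M *** P.
Proof. by rewrite mmulDr mmulNr. Qed.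

Lemma mmulx0 (m n p : nat) (M : 'M[A]_(m, n)) : M *** (0 : 'M_(n, p)) = 0.
Proof. by rewrite -(subrr 0) mmulBr subrr. Qed.

(** A normed algebra carries no distinguished unit, so the diagonal entry is a parameter. *)
Definition idmx (e : A) (n : nat) : 'M[A]_n :=
  \matrix_(i, j) (if i == j then e else 0).

Lemma mmul_const (x y : A) :
  (const_mx x : 'M_1) *** (const_mx y : 'M_1) = const_mx (x ** y).
Proof. by apply/matrixP => i j; rewrite !mxE big_ord1 !mxE. Qed.

Lemma idmx1 (e : A) : idmx e 1 = const_mx e.
Proof. by apply/matrixP => i j; rewrite !ord1 !mxE. Qed.

Variables (e : A) (ide : is_identity e).

Lemma mmul1l (m n : nat) (M : 'M[A]_(m, n)) : idmx e m *** M = M.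
Proof.
apply/matrixP => i k; rewrite mxE (bigD1 i)//= mxE eqxx (ide _).1.
rewrite big1 ?addr0// => j ji.
by rewrite mxE eq_sym (negbTE ji) amul0x.
Qed.

Lemma mmul1r (m n : nat) (M : 'M[A]_(m, n)) : M *** idmx e n = M.
Proof.
apply/matrixP => i k; rewrite mxE (bigD1 k)//= mxE eqxx (ide _).2.
rewrite big1 ?addr0// => j jk.
by rewrite mxE (negbTE jk) amulx0.
Qed.

Lemma is_identity_mxP (n : nat) (M : 'M[A]_n) :
  is_identity_mx M <-> M = idmx e n.
Proof.
split=> [idM|-> i j]; last first.
  by rewrite mxE; case: (i =P j).
apply/matrixP => i j; rewrite mxE; have := idM i j.
by case: (i =P j) => // _ /is_identity_uniq; apply.
Qed.

Lemma RgP (n : nat) (a : 'rV[A]_n) :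
  Rg a <-> exists b : 'cV[A]_n, a *** b = idmx e 1.
Proof.
split=> [[b idab]|[b ab]].
  exists b^T; apply/matrixP => i j; rewrite !mxE !ord1 eqxx.
  rewrite -(is_identity_uniq idab ide).
  by apply: eq_bigr => k _; rewrite mxE.
exists b^T; suff -> : \sum_i a ord0 i ** b^T ord0 i = e by [].
transitivity ((a *** b) ord0 ord0); last by rewrite ab mxE eqxx.
by rewrite mxE; apply: eq_bigr => k _; rewrite mxE.
Qed.

(* Right multiplication of a row by [1 - mu U d] corrects it by a multiple of
   [d]: this is how rows are moved to a prescribed class modulo the ideal. *)
Lemma sherman_morrison (n : nat) (mu : 'cV[A]_n) (d : 'rV[A]_n) (U : 'M[A]_1) :
  U *** (idmx e 1 + d *** mu) = idmx e 1 ->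
  (idmx e n - mu *** U *** d) *** (idmx e n + mu *** d) = idmx e n.
Proof.
move=> UE; rewrite mmulBl mmul1l mmulDr mmul1r.
have -> : mu *** U *** d *** (mu *** d) = mu *** (U *** (d *** mu)) *** d.
  by rewrite !mmulA.
rewrite -mmulDl -mmulDr -{1}(mmul1r U) -mmulDr UE mmul1r.
by rewrite addrK.
Qed.

Lemma sherman_morrisonC (n : nat) (mu : 'cV[A]_n) (d : 'rV[A]_n) (U : 'M[A]_1) :
  (idmx e 1 + d *** mu) *** U = idmx e 1 ->
  (idmx e n + mu *** d) *** (idmx e n - mu *** U *** d) = idmx e n.
Proof.
move=> UE; rewrite mmulDl mmul1l mmulBr mmul1r.
have -> : mu *** d *** (mu *** U *** d) = mu *** (d *** mu *** U) *** d.
  by rewrite !mmulA.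
have E : mu *** U *** d + mu *** (d *** mu *** U) *** d = mu *** d.
  by rewrite -mmulDl -mmulDr -{1}(mmul1l U) -mmulDl UE mmul1r.
by rewrite -{1}E addrK subrK.
Qed.

End MatrixProduct.

Lemma map_mmul (R : realType) (A B : normedAlgType R[i])
    (f : {additive A -> B}) :
  {morph f : x y / x ** y} ->
  forall (m n p : nat) (M : 'M[A]_(m, n)) (N : 'M[A]_(n, p)),
  map_mx f (M *** N) = map_mx f M *** map_mx f N.
Proof.
move=> fM m n p M N; apply/matrixP => i k; rewrite !mxE raddf_sum.
by apply: eq_bigr => j _; rewrite fM !mxE.
Qed.

Lemma map_idmx (R : realType) (A B : normedAlgType R[i]) (f : {additive A -> B})
    (e : A) (n : nat) :
  map_mx f (idmx e n) = idmx (f e) n.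
Proof. by apply/matrixP => i j; rewrite !mxE; case: eqP; rewrite ?raddf0. Qed.

(** One tolerance for two linear error bounds, given by a formula since the order is only partial. A
    single bound is the case [C2 = 0], [e2 = 1]. *)
Lemma exists_small (K : numFieldType) (C1 e1 C2 e2 : K) :
  0 <= C1 -> 0 < e1 -> 0 <= C2 -> 0 < e2 ->
  exists d, [/\ 0 < d, d <= 1, C1 * d < e1 & C2 * d < e2].
Proof.
move=> C10 e10 C20 e20.
have q1 : 0 <= C1 / e1 by rewrite divr_ge0// ltW.
have q2 : 0 <= C2 / e2 by rewrite divr_ge0// ltW.
have D1 : 1 <= 1 + C1 / e1 + C2 / e2 by rewrite -addrA lerDl addr_ge0.
have D0 := lt_le_trans ltr01 D1.
exists (1 + C1 / e1 + C2 / e2)^-1; split.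
- by rewrite invr_gt0.
- by rewrite invf_le1.
- by rewrite ltr_pdivrMr// -ltr_pdivrMl// mulrC addrAC ltrDr ltr_wpDr.
- by rewrite ltr_pdivrMr// -ltr_pdivrMl// mulrC ltrDr ltr_wpDr.
Qed.

Lemma linear_continuous_bound (K : numFieldType) (V W : normedModType K)
    (f : V -> W) :
  linear f -> continuous f -> exists2 C, 0 <= C & forall x, `|f x| <= C * `|x|.
Proof.
move=> fL fc; pose g : {linear V -> W} :=
  HB.pack f (GRing.isLinear.Build K V W _ f fL).
have /linear_boundedP : bounded_near g (nbhs (0 : V)).
  by apply: continuous_linear_bounded; exact: fc.
move=> [M [Mreal HM]]; exists (`|M| + 1); first by rewrite addr_ge0.
by apply: HM; rewrite ltr_pwDr// real_ler_norm.
Qed.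

(** * Density of right invertible rows *)

Section RowDensity.
Variables (R : realType) (A : normedAlgType R[i]).

Lemma row_denseP (n : nat) (S : set 'rV[A]_n) :
  dense S <-> forall (a : 'rV[A]_n) (eps : R[i]), 0 < eps ->
    exists2 b, S b & forall i, `|b ord0 i - a ord0 i| < eps.
Proof.
split=> [dS a eps eps0|dS U [a Ua] oU].
  have /dS : (ball a eps)^° !=set0.
    by exists a; apply: nbhsx_ballx.
  move=> /(_ (open_interior _))[b [/interior_subset [_ ab] Sb]].
  exists b => // i.
  by have := ab ord0 i; rewrite -ball_normE /= distrC.
have /nbhs_ballP[/= eps eps0 aU] : nbhs a U by apply: open_nbhs_nbhs.
have [b Sb ab] := dS a eps eps0; exists b; split => //.
apply: aU; split => // i j; rewrite ord1 -ball_normE /= distrC; exact: ab.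
Qed.

Lemma mmul_bound (n p : nat) (M : 'M[A]_(n, p)) :
  exists2 C, 0 <= C & forall (x : 'rV[A]_n) (d : R[i]), 0 <= d ->
    (forall i, `|x ord0 i| <= d) -> forall j, `|(x *** M) ord0 j| <= C * d.
Proof.
exists (\sum_j \sum_i `|M i j|).
  by apply: sumr_ge0 => j _; exact: sumr_ge0.
move=> x d d0 xd j; rewrite mxE.
apply: (@le_trans _ _ ((\sum_i `|M i j|) * d)).
  rewrite mulr_suml; apply: (le_trans (ler_norm_sum _ _ _)).
  apply: ler_sum => i _; apply: (le_trans (ler_norm_amul _ _)).
  by rewrite mulrC ler_wpM2l.
apply: ler_wpM2r => //; rewrite [leRHS](bigD1 j)//= lerDl.
by apply: sumr_ge0 => k _; exact: sumr_ge0.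
Qed.

(** The first entry is kept and gets the coefficient 0 in the right inverse; only the other entries
    are approximated. *)
Lemma dense_RgS (n : nat) : dense (@Rg R A n) -> dense (@Rg R A n.+1).
Proof.
move=> /row_denseP dR; apply/row_denseP => a eps eps0.
have [b [c idbc] ab] := dR (\row_j a ord0 (lift ord0 j)) eps eps0.
exists (\row_j if unlift ord0 j is Some i then b ord0 i else a ord0 ord0).
  exists (\row_j if unlift ord0 j is Some i then c ord0 i else 0).
  rewrite big_ord_recl !mxE unlift_none amulx0 add0r.
  by under eq_bigr do rewrite !mxE liftK.
move=> j; rewrite mxE; case: unliftP => [i ->|->]; last by rewrite subrr normr0.
by have := ab i; rewrite mxE.
Qed.

Lemma dense_Rg_leq (m n : nat) :
  (m <= n)%N -> dense (@Rg R A m) -> dense (@Rg R A n).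
Proof.
move=> /subnK <-; elim: (n - m)%N => //= k IH dm.
by apply: dense_RgS; exact: IH.
Qed.

End RowDensity.

(** * Least positive integers in the extended reals *)

Section LeastPos.
Variables (R : realType).
Implicit Types P Q S : nat -> Prop.
Local Open Scope ereal_scope.

Variant least_pos_spec P : \bar R -> Prop :=
| LeastPosFin n of (0 < n)%N & P n
    & (forall m, (0 < m)%N -> P m -> (n <= m)%N) :
    least_pos_spec P n%:R%:E
| LeastPosInfty of (forall n, (0 < n)%N -> ~ P n) : least_pos_spec P +oo.

Lemma least_posP P : least_pos_spec P (least_pos R P).
Proof.
rewrite /least_pos; case: pselect => [exP|nexP].
  case: ex_minnP => n /asboolP[n0 Pn] nmin; constructor => // m m0 Pm.
  by apply: nmin; apply/asboolP.
by constructor => n n0 Pn; apply: nexP; exists n; apply/asboolP.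
Qed.

Lemma le_least_pos P Q :
  (forall n, (0 < n)%N -> P n -> Q n) -> least_pos R Q <= least_pos R P.
Proof.
move=> PQ; case: (least_posP P) => [n n0 Pn _|_]; last exact: leey.
case: (least_posP Q) => [m _ _ mmin|/(_ _ n0)[]]; last exact: PQ.
by rewrite lee_fin ler_nat; apply: mmin => //; exact: PQ.
Qed.

(** Upward closure makes [P] and [Q] hold together at the larger of their minima. *)
Lemma least_pos_le_max P Q S :
  (forall m n, (m <= n)%N -> P m -> P n) ->
  (forall m n, (m <= n)%N -> Q m -> Q n) ->
  (forall n, (0 < n)%N -> P n -> Q n -> S n) ->
  least_pos R S <= Order.max (least_pos R P) (least_pos R Q).
Proof.
move=> Pup Qup PQS.
case: (least_posP P) => [m m0 Pm _|_]; last by rewrite max_l leey.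
case: (least_posP Q) => [n n0 Qn _|_]; last by rewrite max_r leey.
rewrite -EFin_max -natr_max.
case: (least_posP S) => [k _ _ kmin|].
  rewrite lee_fin ler_nat; apply: kmin; first by rewrite leq_max m0.
  by apply: PQS; [rewrite leq_max m0|apply: Pup Pm; rewrite leq_maxl|
    apply: Qup Qn; rewrite leq_maxr].
move=> /(_ (maxn m n)) []; first by rewrite leq_max m0.
by apply: PQS; [rewrite leq_max m0|apply: Pup Pm; rewrite leq_maxl|
  apply: Qup Qn; rewrite leq_maxr].
Qed.

Lemma least_pos_ge1 P : 1 <= least_pos R P.
Proof.
by case: (least_posP P) => [n n0 _ _|_]; rewrite ?leey// lee_fin ler1n.
Qed.

Lemma least_pos_eq1 P : least_pos R P = 1 -> P 1%N.
Proof.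
case: (least_posP P) => [n _ Pn _ [/eqP]|_ //].
by rewrite pnatr_eq1 => /eqP n1; rewrite -n1.
Qed.

End LeastPos.

(** * Inversion near the identity in a Banach algebra *)

Section Neumann.
Variable R : realType.

Lemma ltr_complex_bound (x : R[i]) : 0 <= x -> exists n : nat, x < n%:R.
Proof.
move=> x0; exists (Num.bound (complex.Re x)).
have xE : (real_complex R (complex.Re x)) = x by rewrite RRe_real// ger0_real.
rewrite -xE -(rmorph_nat (real_complex R)) ltcR archi_boundP//.
by rewrite -ler0c xE.
Qed.

(** Picard iteration from 0: the steps decrease geometrically, so the iterates are Cauchy and their
    limit is fixed. *)
Lemma half_contraction_fixpoint (V : completeNormedModType R[i]) (f : V -> V) :
  (forall x y, `|f x - f y| <= 2^-1 * `|x - y|) -> exists x, f x = x.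
Proof.
move=> fctr; pose y n := iter n f 0; pose D := `|y 1%N - y 0%N|.
have D0 : 0 <= D by exact: normr_ge0.
have ystep n : `|y n.+1 - y n| <= 2^-1 ^+ n * D.
  elim: n => [|n IH]; first by rewrite expr0 mul1r.
  by rewrite exprS -mulrA (le_trans (fctr _ _))// ler_wpM2l// invr_ge0.
(* The bound is kept as a partial sum of the geometric series, so that the induction on [k]
   closes. *)
have ydist n k : `|y (k + n)%N - y n| <= 2 * D * (2^-1 ^+ n - 2^-1 ^+ (k + n)).
  elim: k => [|k IH]; first by rewrite !subrr normr0 mulr0.
  rewrite (le_trans (ler_distD (y (k + n)%N) _ _))//.
  rewrite (le_trans (lerD (ystep _) IH))// addSn exprS.
  set q := 2^-1 ^+ (k + n); set r := 2^-1 ^+ n.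
  suff -> : q * D + 2 * D * (r - q) = 2 * D * (r - 2^-1 * q) by [].
  by field.
have ylt n m N : (N <= n)%N -> (N <= m)%N -> `|y n - y m| <= 4 * D * 2^-1 ^+ N.
  have bnd k : (N <= k)%N -> `|y k - y N| <= 2 * D * 2^-1 ^+ N.
    move=> /subnK <-; rewrite (le_trans (ydist _ _))//.
    by rewrite ler_wpM2l ?mulr_ge0// lerBlDr lerDl.
  move=> Nn Nm; rewrite (le_trans (ler_distD (y N) _ _))//.
  have -> : 4 * D * 2^-1 ^+ N = 2 * D * 2^-1 ^+ N + 2 * D * 2^-1 ^+ N.
    by rewrite -!mulrDl -natrD.
  by rewrite lerD ?bnd// distrC bnd.
have ycv : cvg (y @ \oo).
  apply/cauchy_cvgP/cauchy_ballP => eps eps0; near_simpl.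
  have [N HN] : exists N : nat, 4 * D / eps < N%:R.
    by apply: ltr_complex_bound; rewrite divr_ge0 ?mulr_ge0// ltW.
  exists ([set n | N <= n], [set n | N <= n])%N; first by split; exists N.
  move=> [n m] [/= Nn Nm]; rewrite /= -ball_normE /=.
  rewrite (le_lt_trans (ylt _ _ _ Nn Nm))//.
  (* [N < 2 ^ N] turns the Archimedean choice of [N] into smallness of [2^-1 ^+ N]. *)
  rewrite exprVn ltr_pdivrMr ?exprn_gt0// -ltr_pdivrMl// mulrC.
  rewrite (lt_le_trans HN)// -natrX ler_nat ltnW// ltn_expl//.
exists (lim (y @ \oo)); apply/esym.
apply: cvg_lim => //.
apply/cvgrPdist_lt => eps eps0; apply: near_inftyS => /=.
move/cvgrPdist_lt : ycv => /(_ eps eps0); apply: filterS => n /=.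
apply: le_lt_trans; rewrite (le_trans (fctr _ _))// ler_piMl//.
by rewrite invf_le1// ler1n.
Qed.

(** A left inverse is a fixed point of [x] to [e - x ** s], a right inverse one of [y] to
    [e - s ** y]; associativity identifies them. The norm of [e] enters the bound as it may exceed
    1. *)
Lemma neumann (A : banachAlgType R[i]) (e s : A) :
  is_identity e -> `|s| <= 2^-1 ->
  exists u, [/\ u ** (e + s) = e, (e + s) ** u = e & `|u| <= 2 * `|e|].
Proof.
move=> ide s2.
have [x xE] : exists x : A, e - x ** s = x.
  apply: half_contraction_fixpoint => x y.
  rewrite opprB addrC addrA subrK -amulNx -amulDl addrC.
  rewrite (le_trans (ler_norm_amul _ _))// mulrC.
  by rewrite -[`|- x + y|]normrN opprD opprK ler_wpM2r.
have [y yE] : exists y : A, e - s ** y = y.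
  apply: half_contraction_fixpoint => x' y.
  rewrite opprB addrC addrA subrK -amulxN -amulDr addrC.
  rewrite (le_trans (ler_norm_amul _ _))//.
  by rewrite -[`|- x' + y|]normrN opprD opprK ler_wpM2r.
have xi : x ** (e + s) = e by rewrite amulDr (ide x).2 -{1}xE subrK.
have yi : (e + s) ** y = e by rewrite amulDl (ide y).1 -{1}yE subrK.
have xy : x = y by rewrite -(ide x).2 -yi amulA xi (ide y).1.
exists x; split => //; first by rewrite xy.
have : `|x| <= `|e| + 2^-1 * `|x|.
  rewrite -{1}xE (le_trans (ler_normB _ _))// lerD2l.
  by rewrite (le_trans (ler_norm_amul _ _))// mulrC ler_wpM2r.
rewrite -lerBlDr -{1}(mul1r `|x|) -mulrBl.
have -> : 1 - 2^-1 = 2^-1 :> R[i].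
  by rewrite {1}(splitr 1) mul1r addrK.
by rewrite ler_pdivrMl.
Qed.

End Neumann.

(** * Moving a right invertible row to a prescribed image under an idempotent endomorphism *)

(** A nearby right invertible [a1] has p(a1) = p(a0) + d. As p(a0) mu = 1, multiplying by 1 - mu U d
    with U the inverse of 1 + d mu subtracts exactly d from p(a1). *)
Lemma row_correction (R : realType) (A : banachAlgType R[i]) (e : A)
    (p : {additive A -> A}) (C : R[i]) (n : nat) (a0 : 'rV[A]_n)
    (mu : 'cV[A]_n) (eps : R[i]) :
  is_identity e -> {morph p : x y / x ** y} -> p e = e ->
  (forall x, p (p x) = p x) -> 0 <= C -> (forall x, `|p x| <= C * `|x|) ->
  dense (@Rg R A n) -> map_mx p a0 *** mu = idmx e 1 -> map_mx p mu = mu ->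
  0 < eps ->
  exists a b, [/\ a *** b = idmx e 1, map_mx p a = map_mx p a0, map_mx p b = mu
    & forall i, `|a ord0 i - a0 ord0 i| < eps].
Proof.
move=> ide pM pe pp C0 pC /row_denseP dR a0mu pmu eps0.
have pmM := map_mmul pM; have p1 m : map_mx p (idmx e m) = idmx e m.
  by rewrite map_idmx pe.
have [Cmu Cmu0 muC] := mmul_bound mu.
pose K := `|(a0 *** mu) ord0 ord0| + Cmu.
have K0 : 0 <= K by rewrite addr_ge0.
have h0 : 0 < 2^-1 :> R[i] by rewrite invr_gt0.
have CC0 : 0 <= Cmu * C by rewrite mulr_ge0.
have KK0 : 0 <= 1 + K * (2 * `|e|) * C by rewrite addr_ge0// !mulr_ge0.
(* The first bound brings [d *** mu] within reach of [neumann]; the second covers the error of [a1]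
   plus the correction a1 mu U d, where [K] bounds a1 mu. *)
have [del [del0 del1 delC delK]] := exists_small CC0 h0 KK0 eps0.
have [a1 /(RgP ide)[b1 ab1] aa1] := dR a0 _ del0.
pose d := map_mx p (a1 - a0).
have pd : map_mx p d = d by apply/matrixP => i j; rewrite !mxE pp.
have dC i : `|d ord0 i| <= C * del.
  by rewrite !mxE (le_trans (pC _))// ler_wpM2l// ltW// aa1.
have sC : `|(d *** mu) ord0 ord0| <= 2^-1.
  rewrite (le_trans (muC d (C * del) _ dC _)) ?mulr_ge0 ?(ltW del0)//.
  by rewrite mulrA ltW.
have [u [ue eu uC]] := neumann ide sC.
pose U : 'M[A]_1 := const_mx u.
have seE : idmx e 1 + d *** mu = const_mx (e + (d *** mu) ord0 ord0).
  by apply/matrixP => i j; rewrite !ord1 !mxE.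
have UE : U *** (idmx e 1 + d *** mu) = idmx e 1
  by rewrite seE mmul_const ue -idmx1.
have EU : (idmx e 1 + d *** mu) *** U = idmx e 1
  by rewrite seE mmul_const eu -idmx1.
(* [U] inverts an element fixed by [p], so its image inverts the same element. *)
have pU : map_mx p U = U.
  rewrite -[LHS](mmul1r ide) -EU mmulA.
  have -> : idmx e 1 + d *** mu = map_mx p (idmx e 1 + d *** mu).
    by rewrite map_mxD p1 pmM pd pmu.
  by rewrite -pmM UE p1 mmul1l.
pose a := a1 *** (idmx e n - mu *** U *** d).
pose b' := (idmx e n + mu *** d) *** b1.
have ab' : a *** b' = idmx e 1.
  by rewrite /a /b' mmulA -(mmulA a1) sherman_morrison// mmul1r.
have pa : map_mx p a = map_mx p a0.
  have pa1 : map_mx p a1 = map_mx p a0 + d.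
    by rewrite /d map_mxB addrC subrK.
  rewrite /a pmM map_mxB p1 !pmM pmu pU pd mmulBr mmul1r// !mmulA.
  by rewrite {2}pa1 mmulDl a0mu EU mmul1l// pa1 addrK.
have aE : a = a1 - a1 *** mu *** U *** d by rewrite /a mmulBr mmul1r// !mmulA.
(* Subtracting [z] from [b'] gives the image [mu] but spoils the product by a z. Adding b' (a z)
   repairs it and is killed by [p], because p(a z) = 1 - 1 = 0. *)
clearbody a b'; pose z := map_mx p b' - mu.
have pz : map_mx p z = z.
  rewrite /z map_mxB pmu; congr (_ - _).
  by apply/matrixP => i j; rewrite !mxE pp.
have paz : map_mx p (a *** z) = 0.
  by rewrite pmM pz pa /z mmulBr a0mu -{1}pa -pmM ab' p1 subrr.
exists a, (b' - z + b' *** (a *** z)); split => //.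
- by rewrite mmulDr mmulBr mmulA ab' mmul1l// subrK.
- have -> : map_mx p (b' - z + b' *** (a *** z)) =
            map_mx p b' - map_mx p z + map_mx p b' *** map_mx p (a *** z).
    by rewrite map_mxD map_mxB pmM.
  by rewrite pz paz mmulx0 addr0 subKr.
move=> i.
have a1mu : `|(a1 *** mu) ord0 ord0| <= K.
  rewrite -(subrK a0 a1) mmulDl mxE addrC (le_trans (ler_normD _ _))// lerD2l.
  rewrite (le_trans (muC _ del _ _ _)) ?(ltW del0)//; last by rewrite ler_piMr.
  by move=> j; rewrite !mxE ltW.
have dE : (a1 *** mu *** U *** d) ord0 i =
    (a1 *** mu) ord0 ord0 ** u ** d ord0 i.
  by rewrite mxE big_ord1; congr (_ ** _); rewrite mxE big_ord1 [U _ _]mxE.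
have -> : a ord0 i - a0 ord0 i =
    (a1 ord0 i - a0 ord0 i) - (a1 *** mu) ord0 ord0 ** u ** d ord0 i.
  by rewrite aE -dE; move: (_ *** d) => Y; rewrite !mxE addrAC.
rewrite (le_lt_trans (ler_normB _ _))// (le_lt_trans _ delK)// mulrDl mul1r.
rewrite lerD ?(ltW (aa1 _))// (le_trans (ler_norm_amul _ _))// -[leRHS]mulrA.
apply: ler_pM => //; last exact: dC.
by apply: (le_trans (ler_norm_amul _ _)); exact: ler_pM.
Qed.

(** * The quotient map as a contractive homomorphism *)

Section QuotientMap.
Variables (R : realType) (A : normedAlgType R[i]) (J : closedIdeal A).

Lemma quo_linear : linear (@quo R A J).
Proof. by move=> k x y; rewrite quoD quo_scale. Qed.

HB.instance Definition _ :=
  GRing.isLinear.Build R[i] A (quotient J) _ (@quo R A J) quo_linear.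

Lemma quo_eq0 (x : A) : quo J x = 0 <-> x \in J.
Proof. by rewrite -(quo0 J) quo_eq subr0. Qed.

Lemma quo_norm_le (x : A) : `|quo J x| <= `|x|.
Proof.
have ReE (y : A) : real_complex R (complex.Re `|y|) = `|y|.
  by rewrite RRe_real// normr_real.
rewrite quo_normE -[leRHS]ReE lecR; apply: ge_inf; last by exists x.
by exists 0 => _ [y _ <-]; rewrite -ler0c ReE.
Qed.

Lemma quo_identity (e : A) : is_identity e -> is_identity (quo J e).
Proof.
move=> ide x; have [a <-] := quo_surj x.
by rewrite -!quo_amul (ide a).1 (ide a).2.
Qed.

Lemma dense_Rg_quotient (n : nat) :
  unital A -> dense (@Rg R A n) -> dense (@Rg R (quotient J) n).
Proof.
move=> [e ide] /row_denseP dR; apply/row_denseP => x eps eps0.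
have [a /(RgP ide)[b ab] ax] :=
  dR (\row_i repr (x ord0 i : Quotient.quot J)) _ eps0.
exists (map_mx (@quo R A J) a).
  apply/(RgP (quo_identity ide)); exists (map_mx (@quo R A J) b).
  by rewrite -(map_mmul (@quo_amul R A J)) ab map_idmx.
move=> i; rewrite !mxE -(quo_repr (x ord0 i)) -raddfB.
by apply: le_lt_trans (quo_norm_le _) _; have := ax i; rewrite mxE.
Qed.

End QuotientMap.

(** * The unitization of the ideal, mapped into the algebra *)

Section UnitEmbed.
Variables (R : realType) (A : normedAlgType R[i]) (J : closedIdeal A) (e : A).
Hypothesis ide : is_identity e.
Local Notation U := (unitization (ideal_alg J)).

Definition unit_embed (u : U) : A := u.1 *: e + ideal_val u.2.

Lemma unit_embed_linear : linear unit_embed.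
Proof.
move=> k [l x] [m y].
by rewrite /unit_embed/= scalerDl scalerDr scalerA addrACA.
Qed.

HB.instance Definition _ :=
  GRing.isLinear.Build R[i] U A _ unit_embed unit_embed_linear.

Lemma unit_embedM : {morph unit_embed : u v / u ** v}.
Proof.
move=> [k x] [l y]; rewrite amul_unitizationE /unit_embed /=.
rewrite amulDl !amulDr !amulZl !amulZr (ide _).1 (ide _).1 (ide _).2 scalerA.
by rewrite -!addrA.
Qed.

Lemma unit_embed1 : unit_embed (1, 0) = e.
Proof. by rewrite /unit_embed/= scale1r addr0. Qed.

(** If [e] lies in [J], the value does not determine the scalar part, which is therefore compared
    separately. *)
Lemma unit_embed_inj (u v : U) :
  u.1 = v.1 -> unit_embed u = unit_embed v -> u = v.
Proof.
case: u v => [k x] [l y] /= ->; rewrite /unit_embed/= => /addrI xy.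
by congr pair; apply: val_inj.
Qed.

Lemma norm_unit_embed (u : U) : `|unit_embed u| <= (`|e| + 1) * `|u|.
Proof.
rewrite (le_trans (ler_normD _ _))// normrZ norm_unitizationE -ideal_normE.
by rewrite mulrDl mul1r mulrDr mulrC lerD// ?lerDl ?lerDr ?mulr_ge0.
Qed.

Lemma unit_embed_lift (m n : nat) (a : 'M[A]_(m, n)) (k : 'M[R[i]]_(m, n)) :
  (forall i j, quo J (a i j) = k i j *: quo J e) ->
  exists2 y : 'M[U]_(m, n), map_mx unit_embed y = a
    & forall i j, (y i j).1 = k i j.
Proof.
move=> ak; have aJ i j : a i j - k i j *: e \in J.
  by apply/quo_eq; rewrite ak quo_scale.
exists (\matrix_(i, j) (k i j, IdealAlg (aJ i j))).
  by apply/matrixP => i j; rewrite !mxE /unit_embed /= addrC subrK.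
by move=> i j; rewrite mxE.
Qed.

End UnitEmbed.

(** * Transfer of density between [A] and the unitization of [J] *)

Section SplitIdeal.
Variables (R : realType) (A : banachAlgType R[i]) (J : closedIdeal A) (e : A).
Hypothesis ide : is_identity e.
Variables (sigma : {linear quotient J -> A}) (C : R[i]).
Hypothesis sigmaM : {morph sigma : x y / x ** y}.
Hypothesis sigma1 : sigma (quo J e) = e.
Hypothesis sigmaK : cancel sigma (@quo R A J).
Hypothesis C0 : 0 <= C.
Hypothesis sigmaC : forall x, `|sigma x| <= C * `|x|.
Local Notation U := (unitization (ideal_alg J)).
Local Notation B := (quotient J).
Local Notation qu := (@quo R A J).

Let quoM' : {morph qu : x y / x ** y} := @quo_amul R A J.

(** [row_correction] yields a row and a right inverse that are both scalar modulo [J], so the pair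
    lifts to the unitization. *)
Lemma dense_Rg_unitization_ideal (n : nat) :
  dense (@Rg R A n.+1) -> dense (@Rg R U n.+1).
Proof.
move=> dR; apply/row_denseP => u eps eps0.
have eps20 : 0 < eps / 2 by rewrite divr_gt0.
(* Only a vanishing first scalar is altered, by half the tolerance, so that the row of scalars
   becomes right invertible. *)
pose l (i : 'I_n.+1) : R[i] :=
  if (i == ord0) && ((u ord0 i).1 == 0) then eps / 2 else (u ord0 i).1.
have l0 : l ord0 != 0.
  by rewrite /l eqxx /=; case: ifP => [_|/negbT//]; rewrite gt_eqF.
have lu i : `|l i - (u ord0 i).1| <= eps / 2.
  rewrite /l; case: ifP => [/andP[_ /eqP ->]|_].
    by rewrite subr0 gtr0_norm.
  by rewrite subrr normr0 ltW.
pose k (i : 'I_n.+1) : R[i] := if i == ord0 then (l ord0)^-1 else 0.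
have lk : \sum_(i < n.+1) l i * k i = 1.
  rewrite big_ord_recl /k eqxx mulfV// big1 ?addr0// => i _.
  by rewrite mulr0.
pose a0 := \row_i (l i *: e + ideal_val (u ord0 i).2).
pose mu := \col_(i < n.+1) (k i *: e).
pose p : {additive A -> A} := (sigma \o qu : A -> A).
have quoJ (x : ideal_alg J) : quo J (ideal_val x) = 0.
  by apply/quo_eq0; exact: ideal_valP.
have pZ c : p (c *: e) = c *: e.
  by rewrite /p /= quo_scale linearZ /= sigma1.
have pa0 i : p (a0 ord0 i) = l i *: e.
  by rewrite mxE raddfD pZ /p /= quoJ raddf0 addr0.
have pmu : map_mx p mu = mu.
  by apply/matrixP => i j; rewrite !mxE pZ.
have a0mu : map_mx p a0 *** mu = idmx e 1.
  apply/matrixP => i j; rewrite !ord1 mxE [RHS]mxE eqxx.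
  rewrite -[RHS]scale1r -lk scaler_suml; apply: eq_bigr => m _.
  by rewrite mxE pa0 mxE amulZl amulZr (ide e).1 scalerA.
have pM : {morph p : x y / x ** y}.
  by move=> x y; rewrite /p /= quo_amul sigmaM.
have pe : p e = e by rewrite -[e]scale1r pZ.
have pp x : p (p x) = p x by rewrite /p /= sigmaK.
have pC x : `|p x| <= C * `|x|.
  by rewrite (le_trans (sigmaC _))// ler_wpM2l// quo_norm_le.
have [a [b [ab pa pb aa0]]] :=
  row_correction ide pM pe pp C0 pC dR a0mu pmu eps20.
have [y ya yl] : exists2 y : 'rV[U]_n.+1,
    map_mx (unit_embed e) y = a & forall i j, (y i j).1 = (\row_m l m) i j.
  apply: unit_embed_lift => i j; rewrite ord1 mxE.
  have := congr1 (fun M : 'rV_n.+1 => quo J (M ord0 j)) pa.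
  by rewrite /= mxE [in X in _ = X -> _]mxE pa0 sigmaK quo_scale.
have [z zb zk] : exists2 z : 'cV[U]_n.+1,
    map_mx (unit_embed e) z = b & forall i j, (z i j).1 = (\col_m k m) i j.
  apply: unit_embed_lift => i j; rewrite mxE.
  have := congr1 (fun M : 'cV_n.+1 => quo J (M i j)) pb.
  by rewrite /= mxE [in X in _ = X -> _]mxE sigmaK quo_scale.
exists y.
  apply/(RgP (@unitization_identity _ (ideal_alg J))); exists z.
  apply/matrixP => i j; rewrite !ord1 [RHS]mxE eqxx.
  apply: (@unit_embed_inj _ _ _ e).
    rewrite mxE /= (big_morph (fst : U -> R[i]) (id1 := 0) (op1 := +%R))//.
    rewrite -lk; apply: eq_bigr => m _.
    by rewrite amul_unitizationE /= yl zk !mxE.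
  have := congr1 (fun M : 'M_1 => M ord0 ord0) ab.
  rewrite -ya -zb -(map_mmul (unit_embedM ide)) mxE => ->.
  by rewrite mxE unit_embed1.
(* Half of [eps] pays for the change of scalars. As [a] and [a0] share the scalars [l], the ideal
   parts differ by an entry of [a - a0]. *)
move=> i; rewrite norm_unitizationE [eps]splitr ler_ltD//.
  by have -> : (y ord0 i - u ord0 i).1 = l i - (u ord0 i).1
    by rewrite /= yl mxE.
have := aa0 i; rewrite -ya !mxE /unit_embed yl mxE opprD addrACA subrr add0r.
by [].
Qed.

(** [sigma] lifts invertible matrices to invertible ones, so a row is carried to the unitization,
    approximated there and carried back. *)
Lemma dense_Rg_completion (n : nat) :
  dense [set rho : 'rV[B]_n.+1 | exists M N : 'M[B]_n.+1,
    [/\ M *** N = idmx (quo J e) _, N *** M = idmx (quo J e) _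
      & row ord0 M = rho]] ->
  dense (@Rg R U n.+1) -> dense (@Rg R A n.+1).
Proof.
move=> /row_denseP dS /row_denseP dU; apply/row_denseP => a eps eps0.
have eps20 : 0 < eps / 2 by rewrite divr_gt0.
have [d [d0 _ dC _]] := exists_small C0 eps20 (lexx 0) ltr01.
have [rho [M [N [MN NM Mrho]]] arho] := dS (map_mx qu a) _ d0.
pose sM := map_mx sigma M; pose sN := map_mx sigma N.
have sMN : sM *** sN = idmx e _.
  by rewrite -(map_mmul sigmaM) MN map_idmx /= sigma1.
have sNM : sN *** sM = idmx e _.
  by rewrite -(map_mmul sigmaM) NM map_idmx /= sigma1.
(* Adding the lifted difference makes the class exactly [rho], at a cost of at most [C * d]. *)
pose a1 := a + map_mx sigma (rho - map_mx qu a).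
have a1a i : `|a1 ord0 i - a ord0 i| < eps / 2.
  rewrite [a1 _ _]mxE addrC addKr mxE (le_lt_trans (sigmaC _))//.
  apply: le_lt_trans dC; rewrite ler_wpM2l// ltW//.
  by have := arho i; rewrite !mxE.
have qa1 : map_mx qu a1 = rho.
  have qs (X : 'rV[B]_n.+1) : map_mx qu (map_mx sigma X) = X.
    by apply/matrixP => i j; rewrite !mxE sigmaK.
  by rewrite /a1 map_mxD qs addrC subrK.
(* The class of [a1 *** sN] is the first row of [M *** N], that is (1, 0, ..., 0). *)
have [y yE _] : exists2 y : 'rV[U]_n.+1, map_mx (unit_embed e) y = a1 *** sN
    & forall i j, (y i j).1 = (\row_m (m == ord0)%:R) i j.
  apply: unit_embed_lift => i j; rewrite ord1.
  transitivity (map_mx qu (a1 *** sN) ord0 j); first by rewrite [RHS]mxE.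
  rewrite (map_mmul quoM') qa1 -Mrho.
  have -> : map_mx qu sN = N by apply/matrixP => ? ?; rewrite !mxE sigmaK.
  have -> : (row ord0 M *** N) ord0 j = (M *** N) ord0 j.
    by rewrite !mxE; apply: eq_bigr => m _; rewrite mxE.
  rewrite MN !mxE eq_sym; case: eqP => _; first by rewrite scale1r.
  by rewrite scale0r.
have [CM CM0 sMC] := mmul_bound sM.
have CM10 : 0 <= CM * (`|e| + 1) by rewrite mulr_ge0// addr_ge0.
(* The embedding multiplies errors by at most one plus the norm of [e], and [sM] by at most [CM]. *)
have [d' [d'0 _ d'C _]] := exists_small CM10 eps20 (lexx 0) ltr01.
have [y' /(RgP (@unitization_identity _ (ideal_alg J)))[z yz] yy'] :=
  dU y _ d'0.
pose x := map_mx (unit_embed e) y'.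
exists (x *** sM).
  apply/(RgP ide); exists (sN *** map_mx (unit_embed e) z).
  rewrite mmulA -(mmulA x) sMN mmul1r// -(map_mmul (unit_embedM ide)) yz.
  by rewrite map_idmx /= unit_embed1.
move=> i; have a1E : a1 = a1 *** sN *** sM by rewrite -mmulA sNM mmul1r.
have -> : (x *** sM) ord0 i - a ord0 i =
    ((x - a1 *** sN) *** sM) ord0 i + (a1 ord0 i - a ord0 i).
  by rewrite mmulBl -a1E [in RHS]mxE [X in _ + X + _]mxE addrA subrK.
rewrite (le_lt_trans (ler_normD _ _))// [eps]splitr ler_ltD//.
apply: le_trans (ltW d'C); rewrite -mulrA; apply: sMC.
  by rewrite mulr_ge0 ?addr_ge0 ?(ltW d'0).
move=> j; rewrite -yE /x -map_mxB mxE (le_trans (norm_unit_embed _ _))//.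
by rewrite ler_wpM2l ?addr_ge0// ltW// !mxE yy'.
Qed.

End SplitIdeal.

(** * Ideals with an identity of their own *)

Section UnitalIdeal.
Variables (R : realType) (A : normedAlgType R[i]) (J : closedIdeal A) (e : A).
Hypothesis ide : is_identity e.
Variable g : ideal_alg J.
Hypothesis idg : is_identity g.

Let gval : A := ideal_val g.

Let gl (x : ideal_alg J) : gval ** ideal_val x = ideal_val x.
Proof. by rewrite -[LHS]/(ideal_val (g ** x)) (idg x).1. Qed.

Let gr (x : ideal_alg J) : ideal_val x ** gval = ideal_val x.
Proof. by rewrite -[LHS]/(ideal_val (x ** g)) (idg x).2. Qed.

(** Both products lie in [J], where [g] is the identity: each equals g a g. *)
Lemma ideal_identity_central (a : A) : gval ** a = a ** gval.
Proof.
pose x := IdealAlg (ideal_mulr a _ (ideal_valP g)).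
pose y := IdealAlg (ideal_mull a _ (ideal_valP g)).
by rewrite -[RHS]/(ideal_val y) -(gl y) /= amulA -[LHS]/(ideal_val x) -(gr x).
Qed.

(** As [g] is a central idempotent, this is a homomorphism onto the direct factor [J]. *)
Definition ideal_proj (a : A) : ideal_alg J :=
  IdealAlg (ideal_mulr a _ (ideal_valP g)).

Lemma dense_Rg_unital_ideal (n : nat) :
  dense (@Rg R A n) -> dense (@Rg R (ideal_alg J) n).
Proof.
move=> /row_denseP dR; apply/row_denseP => x eps eps0.
have [d [d0 _ dg _]] := exists_small (normr_ge0 gval) eps0 (lexx 0) ltr01.
have [a [b idab] ax] := dR (map_mx (@ideal_val _ _ J) x) _ d0.
exists (map_mx ideal_proj a).
  exists (map_mx ideal_proj b); suff -> : \sum_i map_mx ideal_proj a ord0 i **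
    map_mx ideal_proj b ord0 i = g by [].
  apply: val_inj; rewrite raddf_sum /= -[RHS](ide gval).2.
  rewrite (is_identity_uniq ide idab) amul_sumr; apply: eq_bigr => i _.
  have gag c : gval ** c ** gval = gval ** c := gr (ideal_proj c).
  by rewrite !mxE /= -/gval [LHS]amulA gag amulA.
move=> i; rewrite ideal_normE mxE /= -(gl (x ord0 i)) -amulxN -amulDr.
rewrite (le_lt_trans (ler_norm_amul _ _))// (le_lt_trans _ dg)//.
by rewrite ler_wpM2l// ltW//; have := ax i; rewrite mxE.
Qed.

(** [A] is the direct product of [J] and h A with h = e - g, a copy of the quotient; rows are
    approximated in each factor separately. *)
Lemma dense_Rg_unital_ideal_ext (sigma : {linear quotient J -> A}) (C : R[i])
    (n : nat) :
  {morph sigma : x y / x ** y} -> sigma (quo J e) = e ->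
  cancel sigma (@quo R A J) -> 0 <= C -> (forall x, `|sigma x| <= C * `|x|) ->
  dense (@Rg R (quotient J) n) -> dense (@Rg R (ideal_alg J) n) ->
  dense (@Rg R A n).
Proof.
move=> sM s1 sK C0 sC /row_denseP dB /row_denseP dJ.
apply/row_denseP => a eps eps0; have eps20 : 0 < eps / 2 by rewrite divr_gt0.
pose h := e - gval.
have h0 : 0 <= `|h| * C by rewrite mulr_ge0.
have [d [d0 _ dh _]] := exists_small h0 eps20 (lexx 0) ltr01.
have [rho /(RgP (quo_identity ide))[mu rhomu] arho] :=
  dB (map_mx (@quo R A J) a) _ d0.
have [x /(RgP idg)[y xy] ax] := dJ (map_mx ideal_proj a) _ eps20.
pose srho := map_mx sigma rho; pose smu := map_mx sigma mu.
have smE : \sum_i srho ord0 i ** smu i ord0 = e.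
  have := congr1 (map_mx sigma) rhomu; rewrite (map_mmul sM) map_idmx /= s1.
  move=> /matrixP /(_ ord0 ord0); rewrite mxE => ->.
  by rewrite mxE.
have xyE : \sum_i ideal_val (x ord0 i) ** ideal_val (y i ord0) = gval.
  transitivity (\val ((x *** y) ord0 ord0)); last by rewrite xy mxE.
  by rewrite mxE raddf_sum.
have hc (b : A) : h ** b = b ** h.
  rewrite /h amulDl amulDr amulNx amulxN ideal_identity_central.
  by rewrite (ide b).1 (ide b).2.
have hJ (z : ideal_alg J) : h ** ideal_val z = 0.
  by rewrite /h amulDl amulNx gl (ide _).1 subrr.
have hh : h ** h = h.
  by rewrite {2}/h amulDr amulxN hJ subr0 (ide h).2.
have hM (X Y : ideal_alg J) (P Q : A) :
    (ideal_val X + h ** P) ** (ideal_val Y + h ** Q) =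
    ideal_val X ** ideal_val Y + h ** (P ** Q).
  rewrite amulDl !amulDr.
  have -> : ideal_val X ** (h ** Q) = 0 by rewrite amulA -hc hJ amul0x.
  have -> : h ** P ** ideal_val Y = 0 by rewrite hc -amulA hJ amulx0.
  have -> : h ** P ** (h ** Q) = h ** (P ** Q).
    by rewrite amulA -(amulA h P h) -(hc P) amulA hh -amulA.
  by rewrite addr0 add0r.
exists (\row_i (ideal_val (x ord0 i) + h ** srho ord0 i)).
  exists (\row_i (ideal_val (y i ord0) + h ** smu i ord0)).
  suff -> : \sum_i (\row_i (ideal_val (x ord0 i) + h ** srho ord0 i)) ord0 i **
     (\row_i (ideal_val (y i ord0) + h ** smu i ord0)) ord0 i = e by [].
  transitivity (\sum_i (ideal_val (x ord0 i) ** ideal_val (y i ord0) +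
                        h ** (srho ord0 i ** smu i ord0))).
    by apply: eq_bigr => i _; rewrite [X in X ** _]mxE [X in _ ** X]mxE hM.
  by rewrite big_split /= -amul_sumr xyE smE (ide h).2 /h addrC subrK.
move=> i; rewrite mxE.
(* [h] kills [J], so in the second factor an element may be replaced by the lift of its class. *)
have hp : h ** a ord0 i = h ** sigma (quo J (a ord0 i)).
  apply/eqP; rewrite -subr_eq0 -amulxN -amulDr; apply/eqP.
  have zJ : a ord0 i - sigma (quo J (a ord0 i)) \in J.
    by apply/quo_eq; rewrite sK.
  exact: (hJ (IdealAlg zJ)).
have -> : ideal_val (x ord0 i) + h ** srho ord0 i - a ord0 i =
  ideal_val (x ord0 i - ideal_proj (a ord0 i)) +
  h ** sigma (rho ord0 i - quo J (a ord0 i)).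
  rewrite (raddfB sigma) /= amulDr amulxN -hp [srho _ _]mxE -/gval.
  have -> : h ** a ord0 i = a ord0 i - gval ** a ord0 i.
    by rewrite /h amulDl amulNx (ide _).1.
  by rewrite addrACA -opprD [gval ** _ + _]addrC subrK.
rewrite (le_lt_trans (ler_normD _ _))// [eps]splitr ltr_leD//.
  by have := ax i; rewrite mxE.
rewrite (le_trans (ler_norm_amul _ _))// (le_trans _ (ltW dh))// -mulrA.
rewrite ler_wpM2l// (le_trans (sC _))// ler_wpM2l// ltW//.
by have := arho i; rewrite mxE.
Qed.

End UnitalIdeal.

(** * Completable rows over a quotient of stable rank one *)

Section TsrOneQuotient.
Variables (R : realType) (A : banachAlgType R[i]) (J : closedIdeal A) (e : A).
Hypothesis ide : is_identity e.
Variables (sigma : {linear quotient J -> A}) (C : R[i]).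
Hypothesis sigma1 : sigma (quo J e) = e.
Hypothesis sigmaK : cancel sigma (@quo R A J).
Hypothesis C0 : 0 <= C.
Hypothesis sigmaC : forall x, `|sigma x| <= C * `|x|.
Hypothesis dense1 : dense (@Rg R (quotient J) 1).
Local Notation B := (quotient J).
Local Notation q := (quo J e).

Let idq : is_identity q := quo_identity ide.

Lemma dense_right_invertible (x : B) (eps : R[i]) : 0 < eps ->
  exists b c, b ** c = q /\ `|b - x| < eps.
Proof.
move=> eps0; have /row_denseP/(_ (\row_ _ x) eps eps0)[b [c]] := dense1.
rewrite big_ord1 => /is_identity_uniq/(_ idq) bc /(_ ord0); rewrite mxE => bx.
by exists (b ord0 ord0), (c ord0 ord0).
Qed.

(* A right inverse [c] of [b] is close to a right invertible [c'], and [b c']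
   is close to 1, hence invertible: so [c'] is invertible and then [b] too. *)
Lemma dense_invertible (x : B) (eps : R[i]) : 0 < eps ->
  exists b c, [/\ b ** c = q, c ** b = q & `|b - x| < eps].
Proof.
move=> eps0; have [b [c [bc bx]]] := dense_right_invertible x eps0.
have Cb0 : 0 <= C * `|b| by rewrite mulr_ge0.
have h0 : 0 < 2^-1 :> R[i] by rewrite invr_gt0.
have [d [d0 _ dC _]] := exists_small Cb0 h0 (lexx 0) ltr01.
have [c' [f [c'f c'c]]] := dense_right_invertible c d0.
pose s := b ** c' - q.
(* The Neumann inverse is taken in the complete algebra [A] and mapped back to the quotient. *)
have sC : `|sigma s| <= 2^-1.
  rewrite (le_trans (sigmaC _))// (le_trans _ (ltW dC))// -mulrA ler_wpM2l//.
  rewrite /s -bc -amulxN -amulDr (le_trans (ler_norm_amul _ _))//.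
  by rewrite ler_wpM2l// ltW.
have [v [ve ev _]] := neumann ide sC.
have es : e + sigma s = sigma (b ** c').
  by rewrite -[e in LHS]sigma1 -raddfD /= /s addrC subrK.
pose w : B := quo J v.
have wb : w ** (b ** c') = q.
  by rewrite -(sigmaK (b ** c')) -quo_amul -es ve.
have bw : (b ** c') ** w = q.
  by rewrite -(sigmaK (b ** c')) -quo_amul -es ev.
exists b, (c' ** w); split => //; first by rewrite amulA.
(* The left inverse [w ** b] of [c'] coincides with its right inverse [f], so [c' ** w] is a left
   inverse of [b]. *)
have wbf : w ** b = f.
  by rewrite -[LHS](idq _).2 -c'f amulA -(amulA w) wb (idq f).1.
by rewrite -amulA wbf.
Qed.

(** With its first entry moved to an invertible [r], the row replaces the first row of the identity
    matrix. The result is 1 + E0 v, invertible because 1 + v E0 = r is. *)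
Lemma dense_first_rows (n : nat) :
  dense [set rho : 'rV[B]_n.+1 | exists M N : 'M[B]_n.+1,
    [/\ M *** N = idmx q _, N *** M = idmx q _ & row ord0 M = rho]].
Proof.
apply/row_denseP => rho eps eps0.
have [r [r' [rr' r'r rrho]]] := dense_invertible (rho ord0 ord0) eps0.
pose rho' : 'rV[B]_n.+1 := \row_j (if j == ord0 then r else rho ord0 j).
pose v : 'rV[B]_n.+1 := rho' - row ord0 (idmx q _).
pose E0 : 'cV[B]_n.+1 := col ord0 (idmx q _).
have vE : idmx q 1 + v *** E0 = const_mx r.
  have -> : v *** E0 = const_mx (v ord0 ord0).
    apply/matrixP => i j; rewrite !ord1 [RHS]mxE.
    rewrite -[in RHS](mmul1r idq v) !mxE; apply: eq_bigr => k _.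
    by rewrite !mxE.
  by apply/matrixP => i j; rewrite !ord1 !mxE eqxx addrC subrK.
exists rho'.
  exists (idmx q _ + E0 *** v), (idmx q _ - E0 *** const_mx r' *** v); split.
  - by apply: sherman_morrisonC; rewrite // vE mmul_const rr' -idmx1.
  - by apply: sherman_morrison; rewrite // vE mmul_const r'r -idmx1.
  - apply/rowP => j; rewrite !mxE big_ord1 !mxE eqxx (idq _).1.
    by rewrite addrC subrK.
move=> i; rewrite mxE; case: eqP => [->//|_].
by rewrite subrr normr0.
Qed.

End TsrOneQuotient.

(** * Comparison of the stable ranks *)

Lemma completely_finite_first_rows (R : realType) (B : normedAlgType R[i])
    (q : B) (n : nat) :
  is_identity q -> completely_finite B ->
  @Rg R B n.+1 `<=` [set rho : 'rV[B]_n.+1 | exists M N : 'M[B]_n.+1,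
    [/\ M *** N = idmx q _, N *** M = idmx q _ & row ord0 M = rho]].
Proof.
move=> idq [_ cfB] rho /(RgP idq)[c /(is_identity_mxP idq) rc].
have [M [N [MN NM Mrho]]] := cfB n rho (ex_intro _ c rc).
by exists M, N; split => //; apply/(is_identity_mxP idq).
Qed.

Lemma denseS (T : topologicalType) (S S' : set T) :
  S `<=` S' -> dense S -> dense S'.
Proof.
move=> SS' dS O O0 Oo; have [x [Ox Sx]] := dS O O0 Oo.
by exists x; split => //; exact: SS'.
Qed.

Lemma rtsr_unital (R : realType) (B : normedAlgType R[i]) :
  unital B -> rtsr B = least_pos R (fun n => dense (@Rg R B n)).
Proof. by move=> uB; rewrite /rtsr asboolT. Qed.

Lemma split_quotient_bounded (R : realType) (A : normedAlgType R[i])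
    (J : closedIdeal A) (e : A) : is_identity e -> split_quotient J ->
  exists (sigma : {linear quotient J -> A}) (C : R[i]),
    [/\ {morph sigma : x y / x ** y}, sigma (quo J e) = e,
        cancel sigma (@quo R A J), 0 <= C & forall x, `|sigma x| <= C * `|x|].
Proof.
move=> ide [s [sL sM s1 sc sK]].
have [C C0 sC] := linear_continuous_bound sL sc.
pose sigma : {linear quotient J -> A} :=
  HB.pack s (GRing.isLinear.Build R[i] (quotient J) A _ s sL).
exists sigma, C; split => //.
exact: (is_identity_uniq (s1 _ (quo_identity ide)) ide).
Qed.

Local Open Scope ereal_scope.

Theorem theorem3p1 (R : realType) (A : banachAlgType R[i]) (J : closedIdeal A)
    (A_unital : unital A) (J_split : split_quotient J) :
  [/\ rtsr (ideal_alg J) <= rtsr A,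
      has_tsr (quotient J) 1 -> rtsr (ideal_alg J) = rtsr A
    & completely_finite (quotient J) ->
      rtsr A = Order.max (rtsr (quotient J)) (rtsr (ideal_alg J))].
Proof.
have [e ide] := A_unital.
have [sigma [C [sM s1 sK C0 sC]]] := split_quotient_bounded ide J_split.
have idq : is_identity (quo J e) := quo_identity ide.
have uB : unital (quotient J) by exists (quo J e).
rewrite (rtsr_unital A_unital) (rtsr_unital uB).
set rA := least_pos R (fun n => dense (@Rg R A n)).
set rB := least_pos R (fun n => dense (@Rg R (quotient J) n)).
have JA : rtsr (ideal_alg J) <= rA.
  rewrite /rtsr; case: asboolP => [[g idg]|_]; apply: le_least_pos => -[//|n] _.
    exact: (dense_Rg_unital_ideal ide idg).
  exact: (dense_Rg_unitization_ideal ide sM s1 sK C0 sC).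
have BA : rB <= rA.
  by apply: le_least_pos => n _; exact: dense_Rg_quotient.
(* The upper bound shared by (ii) and (iii), which differ only in why completable rows over the
   quotient are dense. *)
have Aub : (forall n, dense (@Rg R (quotient J) n.+1) ->
    dense [set rho : 'rV[quotient J]_n.+1 | exists M N : 'M[quotient J]_n.+1,
    [/\ M *** N = idmx (quo J e) _, N *** M = idmx (quo J e) _
      & row ord0 M = rho]]) -> rA <= Order.max rB (rtsr (ideal_alg J)).
  move=> first_rows; rewrite /rtsr.
  case: asboolP => [[g idg]|_].
    apply: least_pos_le_max => [m n mn|m n mn|n _]; try exact: dense_Rg_leq.
    exact: (dense_Rg_unital_ideal_ext ide idg sM s1 sK C0 sC).
  apply: least_pos_le_max => [m n mn|m n mn|[//|n] _ /first_rows dB];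
    try exact: dense_Rg_leq.
  exact: (dense_Rg_completion ide sM s1 sK C0 sC).
split => // [[_ tsr1]|cfB]; apply/le_anti/andP; split => //.
- have rB1 : rB = 1 by rewrite /rB -rtsr_unital.
  have dB1 := least_pos_eq1 rB1.
  have := Aub (fun n _ => dense_first_rows ide s1 sK C0 sC dB1 (n := n)).
  (* Every rank is at least 1, so the maximum is the rank of [J]. *)
  by rewrite rB1 max_r// /rtsr; case: asboolP => _; exact: least_pos_ge1.
(* Here every right invertible row is itself completable. *)
- apply: Aub => n; apply: denseS; exact: completely_finite_first_rows.
- by rewrite ge_max BA.
Qed.
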